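(* For every integer $\ell\ge 2$ there exist constants $0<c_\ell\le C_\ell<\infty$, depending only on $\ell$, such that for every integer $n\ge 1$ and every choice of connected graphs $G_1,\dots,G_n$ with vertex set $\{1,\dots,\ell\}$, the cartesian product $G=G_1\times\cdots\times G_n$ satisfies $$c_\ell\,|V_G|\ \le\ \chi_G^{\mathrm{IP}}\ \le\ C_\ell\,|V_G|,$$ where $\chi_G^{\mathrm{IP}}$ is the comparison constant of the interchange process on $G$.
   Context: Graphs are finite, undirected and simple; $V_G$ and $E_G$ denote the vertex and edge sets of $G$. The cartesian product $G_1\times\cdots\times G_n$ has vertex set $V_{G_1}\times\cdots\times V_{G_n}$, and the neighbors of $x=(x_1,\dots,x_n)$ are obtained by replacing one arbitrary coordinate $x_i$ by an arbitrary neighbor of $x_i$ in $G_i$. So here $|V_G|=\ell^n$. For a finite connected graph $G$, let $\mathfrak{S}(V_G)$ be the symmetric group on $V_G$, and for $e\in E_G$ let $\tau_e$ be the transposition of the endpoints of $e$. The Dirichlet form of the interchange process on $G$ (with unit edge rates) is, for $f:\mathfrak{S}(V_G)\to\mathbb{R}$, $$\mathcal{E}^{\mathrm{IP}}_G(f)=\frac{1}{2\,|V_G|!}\sum_{\sigma\in\mathfrak{S}(V_G)}\sum_{e\in E_G}\big(f(\sigma\tau_e)-f(\sigma)\big)^2 .$$ Let $\mathcal{K}$ denote the complete graph on the vertex set $V_G$. The comparison constant $\chi^{\mathrm{IP}}_G$ is the smallest number such that $\mathcal{E}^{\mathrm{IP}}_{\mathcal{K}}(f)\le \chi^{\mathrm{IP}}_G\,\mathcal{E}^{\mathrm{IP}}_G(f)$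 for all $f:\mathfrak{S}(V_G)\to\mathbb{R}$. *)

(* Defs.v *)
From mathcomp Require Import all_boot all_order all_algebra all_fingroup.
From mathcomp Require Import reals.

Set Implicit Arguments.
Unset Strict Implicit.
Unset Printing Implicit Defensive.

Import Order.TTheory GRing.Theory Num.Theory.
Local Open Scope ring_scope.

Record sgraph (T : finType) := SGraph {
  adj : rel T;
  adj_sym : symmetric adj;
  adj_irrefl : irreflexive adj
}.

Definition sg_connected (T : finType) (G : sgraph T) : Prop :=
  forall x y : T, connect (adj G) x y.

Definition edges (T : finType) (G : sgraph T) : {set {set T}} :=
  [set [set p.1; p.2] | p : T * T & adj G p.1 p.2].

Section CompleteGraph.
Variable T : finType.

Definition complete_adj : rel T := fun x y => x != y.

Lemma complete_adj_sym : symmetric complete_adj.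
Proof. by move=> x y; rewrite /complete_adj eq_sym. Qed.

Lemma complete_adj_irrefl : irreflexive complete_adj.
Proof. by move=> x; rewrite /complete_adj eqxx. Qed.

Definition complete_graph : sgraph T :=
  SGraph complete_adj_sym complete_adj_irrefl.

End CompleteGraph.

Section CartesianProduct.
Variables (T : finType) (n : nat) (G : 'I_n -> sgraph T).

Definition cart_adj : rel {ffun 'I_n -> T} := fun x y =>
  [exists i, adj (G i) (x i) (y i) && [forall j, (j != i) ==> (x j == y j)]].

Lemma cart_adj_sym : symmetric cart_adj.
Proof.
move=> x y; apply: eq_existsb => i; rewrite adj_sym; congr (_ && _).
by apply: eq_forallb => j; rewrite (eq_sym (x j)).
Qed.

Lemma cart_adj_irrefl : irreflexive cart_adj.
Proof. by move=> x; apply/negbTE/existsPn => i; rewrite adj_irrefl. Qed.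

Definition cart_prod : sgraph {ffun 'I_n -> T} :=
  SGraph cart_adj_sym cart_adj_irrefl.

End CartesianProduct.

(* Junk value 1 unless e has exactly two elements; the choice of ordering made
   by enum is irrelevant since tperm x y = tperm y x, see edge_tperm2. *)
Definition edge_tperm (T : finType) (e : {set T}) : {perm T} :=
  if enum e is [:: x; y] then tperm x y else 1%g.

Lemma edge_tperm2 (T : finType) (x y : T) :
  edge_tperm [set x; y] = tperm x y.
Proof.
rewrite /edge_tperm; have [->|xy] := eqVneq x y.
  by rewrite setUid enum_set1 tperm1.
have := cards2 x y; rewrite xy cardE.
have memE z : (z \in enum [set x; y]) = (z == x) || (z == y).
  by rewrite mem_enum !inE.
have := enum_uniq [set x; y].
case: (enum [set x; y]) memE => [|a [|b []]] //= memE.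
rewrite inE andbT => ab _.
have := memE a; have := memE b; rewrite !inE !eqxx orbT /=.
move=> /esym/orP[]/eqP eb /esym/orP[]/eqP ea; subst => //.
- by rewrite eqxx in ab.
- by rewrite tpermC.
- by rewrite eqxx in ab.
Qed.

(* In MathComp (s * t) x = t (s x), so the composite "sigma tau_e", i.e.
   x |-> sigma (tau_e x), is edge_tperm e * sigma. *)
Definition dirichlet_IP (R : realType) (T : finType) (G : sgraph T)
    (f : {perm T} -> R) : R :=
  (2 * (#|T|`!)%:R)^-1 *
  \sum_(sigma : {perm T}) \sum_(e in edges G)
    (f (edge_tperm e * sigma)%g - f sigma) ^+ 2.

Definition IP_comparison (R : realType) (T : finType) (G : sgraph T)
    (chi : R) : Prop :=
  forall f : {perm T} -> R,
    dirichlet_IP (complete_graph T) f <= chi * dirichlet_IP G f.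

Definition is_comparison_constant (R : realType) (T : finType) (G : sgraph T)
    (chi : R) : Prop :=
  IP_comparison G chi /\ forall c : R, IP_comparison G c -> chi <= c.

Lemma comparison_constant_unique (R : realType) (T : finType) (G : sgraph T)
    (chi chi' : R) :
  is_comparison_constant G chi -> is_comparison_constant G chi' -> chi = chi'.
Proof.
by move=> [h m] [h' m']; apply/le_anti; rewrite m // m'.
Qed.

(* Main.v *)
Require Import Defs.
From mathcomp Require Import all_boot all_order all_algebra all_fingroup.
From mathcomp Require Import reals.
From mathcomp Require Import ring lra.

(** Write A(x, y) for [energy f x y], the sum over sigma of
    (f(tau_xy sigma) - f(sigma))^2.  Up to a factor that only depends on the
    number of vertices, the Dirichlet form of a graph is the sum of A over its
    edges, so the task is to bound the sum of A over all pairs of vertices by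
    l^n times its sum over the edges of the product.  Joining two vertices by a
    path would lose powers of n; three comparisons avoid this.

    - Noise against lines.  Let T_r be the kernel that keeps each coordinate with
      probability r and otherwise redraws it uniformly.  The octopus inequality,
      applied around every vertex, shows that the energy averaged over a symmetric
      stochastic kernel at most doubles when the kernel is squared
      ([kernel_energy_square]).  As T_r T_r = T_(r^2), the energy of T_(1/2) is at
      most 2^k times that of T_r with r^(2^k) = 1/2.  When k grows, T_r is to first
      order a jump along a single line of the product, and 2^k (1 - r) stays below
      1: the energy of T_(1/2) is at most the sum of A over pairs on a common line,
      with no loss depending on n ([noise_energy_le_line]).

    - All pairs against noise.  For independent uniform x and y, let z take each
      coordinate from x or from y with a fair coin.  Then (x, z) and (z, y) are
      each distributed as one step of T_(1/2), and tau_xy = tau_xz tau_zy tau_xz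
      bounds A(x, y) by 6 A(x, z) + 3 A(z, y) ([total_energy_le_noise]).

    - Lines against edges.  A line in direction i carries a copy of G_i, a
      connected graph on l vertices, where paths cost only a constant depending
      on l ([line_energy_le_graph]).

    For the lower bound the test function is the indicator that the first
    coordinate of one tagged particle has a given value: the complete graph changes
    that coordinate about l^n times faster than a single factor does
    ([comparison_lower_bound]).

    The octopus inequality is proved as follows.  Let d be real weights on the
    vertices with sum 0, nonnegative except at one vertex o, and let
    W = sum_(x, y) d_x d_y tau_xy in the group algebra; the claim is W >= 0.
    Expanding the square and using that the weights sum to 0 gives
      6 (sum_x d_x^2) W = 3 W^2 - 6 sum_(x, y, z, u) d_x d_y d_z d_u Pi_xyzu,
    where Pi_xyzu, for distinct points, is the orthogonal projection on the vectors
    that are fixed by the Klein four-group of {x, y, z, u} and orthogonal to those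
    fixed by its alternating group ([sum4_klein]).  The same question has thus
    moved from transpositions to the projections Pi, where it has an easy answer:
    spreading d_o = - sum_(v != o) d_v over the terms, it remains to see that
    Pi_xyzu is at most the sum of the four projections obtained by replacing one
    point by o ([klein_octopus]).  This holds in the group algebra of S_5: the five
    projections add up to 2 P for a projection P above each of them, so that the
    sum of four of them minus the fifth is 2 (P - Pi_xyzu). *)

Set Implicit Arguments.
Unset Strict Implicit.
Unset Printing Implicit Defensive.

Import Order.TTheory GRing.Theory Num.Theory.
Local Open Scope ring_scope.

(** * Correlations of a function on a symmetric group *)

Section Correlation.
Variables (R : realFieldType) (T : finType) (f : {perm T} -> R).
Implicit Types (s t : {perm T}) (x y z : T).

(** A positive-definite function on the group: the inequalities of the group
    algebra that are needed are all read off as linear inequalities between its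
    values. *)
Definition corr s : R := \sum_(sigma : {perm T}) f sigma * f (s * sigma)%g.

Definition energy x y : R :=
  \sum_(sigma : {perm T}) (f (tperm x y * sigma)%g - f sigma) ^+ 2.

Lemma corr_shift s t :
  \sum_(sigma : {perm T}) f (s * sigma)%g * f (t * sigma)%g = corr (t * s^-1)%g.
Proof.
rewrite /corr (reindex_inj (mulgI s^-1)%g) /=; apply: eq_bigr => sigma _.
by rewrite !mulgA mulgV mul1g.
Qed.

Lemma corrV s : corr s^-1%g = corr s.
Proof.
rewrite -[RHS](_ : \sum_sigma f (s * sigma)%g * f (1 * sigma)%g = _).
  by rewrite corr_shift mul1g.
by apply: eq_bigr => sigma _; rewrite mul1g mulrC.
Qed.

Lemma corr_gram (I : Type) (r : seq I) (a : I -> R) (s : I -> {perm T}) :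
  \sum_(i <- r) \sum_(j <- r) a i * a j * corr (s j * (s i)^-1)%g
  = \sum_(sigma : {perm T}) (\sum_(i <- r) a i * f (s i * sigma)%g) ^+ 2.
Proof.
transitivity (\sum_(i <- r) \sum_(j <- r) \sum_(sigma : {perm T})
    (a i * f (s i * sigma)%g) * (a j * f (s j * sigma)%g)).
  apply: eq_bigr => i _; apply: eq_bigr => j _.
  rewrite -corr_shift mulr_sumr; apply: eq_bigr => sigma _; ring.
under eq_bigr do rewrite exchange_big.
rewrite exchange_big; apply: eq_bigr => sigma _.
rewrite expr2 mulr_suml; apply: eq_bigr => i _.
by rewrite mulr_sumr.
Qed.

Lemma energyE x y : energy x y = 2 * (corr 1%g - corr (tperm x y)).
Proof.
have E1 : \sum_(sigma : {perm T}) f (tperm x y * sigma)%g ^+ 2 = corr 1%g.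
  rewrite -(mulgV (tperm x y)) -corr_shift.
  by apply: eq_bigr => sigma _; rewrite expr2.
have E0 : \sum_(sigma : {perm T}) f sigma ^+ 2 = corr 1%g.
  by apply: eq_bigr => sigma _; rewrite mul1g expr2.
transitivity (\sum_(sigma : {perm T}) (f (tperm x y * sigma)%g ^+ 2
    + f sigma ^+ 2 - 2 * (f sigma * f (tperm x y * sigma)%g))).
  by apply: eq_bigr => sigma _; ring.
rewrite sumrB big_split /= E1 E0 -mulr_sumr -/(corr _); ring.
Qed.

Lemma energy_ge0 x y : 0 <= energy x y.
Proof. by apply: sumr_ge0 => s _; rewrite sqr_ge0. Qed.

Lemma energyC x y : energy x y = energy y x.
Proof. by rewrite /energy tpermC. Qed.

Lemma energyxx x : energy x x = 0.
Proof. by rewrite energyE tperm1 subrr mulr0. Qed.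

(** The conjugation tau_xy = tau_xz tau_zy tau_xz uses tau_xz twice and tau_zy
    once, and the square of a sum of three terms is at most three times the sum of
    the squares. *)
Lemma energy_triangle x y z : energy x y <= 6 * energy x z + 3 * energy z y.
Proof.
have [->|xz] := eqVneq x z; first by rewrite energyxx; have := energy_ge0 z y; lra.
have [<-|yz] := eqVneq y z; first by rewrite energyxx; have := energy_ge0 x y; lra.
have [->|xy] := eqVneq x y.
  by rewrite energyxx; have := energy_ge0 y z; have := energy_ge0 z y; lra.
have shift u v s : \sum_(sigma : {perm T})
    (f (tperm u v * (s * sigma)) - f (s * sigma))%g ^+ 2 = energy u v.
  by rewrite /energy [RHS](reindex_inj (mulgI s)).
have tE : tperm x y = (tperm x z * tperm z y * tperm x z)%g.
  rewrite -{1}(tpermV x z) -mulgA -/(conjg _ _) tpermJ.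
  by rewrite tpermR tpermD // eq_sym.
have -> : 6 * energy x z + 3 * energy z y = \sum_(sigma : {perm T}) (
   3 * (f (tperm x z * (tperm z y * tperm x z * sigma))
        - f (tperm z y * tperm x z * sigma))%g ^+ 2
   + 3 * (f (tperm z y * (tperm x z * sigma)) - f (tperm x z * sigma))%g ^+ 2
   + 3 * (f (tperm x z * sigma)%g - f sigma) ^+ 2).
  by rewrite !big_split /= -!mulr_sumr !shift /energy; ring.
apply: ler_sum => sigma _; rewrite tE -!mulgA.
set a := f _; set d := f sigma; set b := f (tperm z y * _)%g.
set c := f (tperm x z * sigma)%g.
have := sqr_ge0 ((a - b) - (b - c)); have := sqr_ge0 ((a - b) - (c - d)).
by have := sqr_ge0 ((b - c) - (c - d)); rewrite !expr2; lra.
Qed.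

End Correlation.

(** * Deciding positivity in the group algebra by computation *)

(** A word stands for the product of the transpositions of the points at the
    listed positions, a form for an integer combination of such products. *)
Definition word := seq (nat * nat).
Definition form := seq (int * word).

Definition swap_nat (ij : nat * nat) (k : nat) : nat :=
  if k == ij.1 then ij.2 else if k == ij.2 then ij.1 else k.

Definition word_act (w : word) (k : nat) : nat :=
  foldl (fun k ij => swap_nat ij k) k w.

Definition word_table (n : nat) (w : word) : seq nat :=
  [seq word_act w k | k <- iota 0 n].

Definition word_bounded (n : nat) (w : word) : bool :=
  all (fun ij => (ij.1 < n)%N && (ij.2 < n)%N) w.

Definition table_coef (ts : seq (seq nat * int)) (c : seq nat) : int :=
  foldr (fun t acc => if t.1 == c then t.2 + acc else acc) 0 ts.

Definition form_tables (n : nat) (L : form) : seq (seq nat * int) :=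
  [seq (word_table n t.2, t.1) | t <- L].

(** Every word is replaced by its action on positions, so that forms vanishing in
    the group algebra are recognised by computation. *)
Definition form_null (n : nat) (L : form) : bool :=
  all (fun t => word_bounded n t.2) L &&
  (let ts := form_tables n L in
   all (fun c => table_coef ts c == 0) (undup (unzip1 ts))).

Definition form_rev (L : form) : form := [seq (t.1, rev t.2) | t <- L].
Definition form_scale (a : int) (L : form) : form := [seq (a * t.1, t.2) | t <- L].
(** The product of the form with its adjoint. *)
Definition form_square (L : form) : form :=
  [seq (t.1 * u.1, u.2 ++ rev t.2) | t <- L, u <- L].

(** When L + L^* is self-adjoint with a square that is a positive multiple of
    itself, it is a positive multiple of an orthogonal projection; the multiplier
    is m.+1 to make positivity automatic. *)
Definition form_projective (n m : nat) (L : form) : bool :=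
  form_null n (form_square (L ++ form_rev L) ++ form_scale (- m.+1%:Z) (L ++ form_rev L)).

Section Forms.
Variables (R : realFieldType) (T : finType) (f : {perm T} -> R).
Variables (x0 : T) (pts : seq T).

Definition word_perm (w : word) : {perm T} :=
  (\prod_(ij <- w) tperm (nth x0 pts ij.1) (nth x0 pts ij.2))%g.

Definition form_eval (L : form) : R :=
  \sum_(t <- L) t.1%:~R * corr f (word_perm t.2).

Lemma word_perm_rev w : word_perm (rev w) = (word_perm w)^-1%g.
Proof.
rewrite /word_perm; elim: w => [|ij w IH]; first by rewrite !big_nil invg1.
by rewrite rev_cons -cats1 big_cat /= big_seq1 IH big_cons invMg tpermV.
Qed.

Lemma word_perm_cat w w' : word_perm (w ++ w') = (word_perm w * word_perm w')%g.
Proof. by rewrite /word_perm big_cat. Qed.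

Hypothesis Upts : uniq pts.
Let n := size pts.

Lemma swap_nat_lt ij k :
  (ij.1 < n)%N -> (ij.2 < n)%N -> (k < n)%N -> (swap_nat ij k < n)%N.
Proof. by rewrite /swap_nat => ? ? ?; do 2?case: ifP. Qed.

Lemma word_permE w k : word_bounded n w -> (k < n)%N ->
  word_perm w (nth x0 pts k) = nth x0 pts (word_act w k).
Proof.
rewrite /word_perm; elim: w k => [|ij w IH] k /=; first by rewrite big_nil perm1.
case/andP=> /andP[i_n j_n] wb kn; rewrite big_cons permM.
rewrite -IH ?swap_nat_lt //; congr (fun_of_perm _ _).
by rewrite /swap_nat permE /= !nth_uniq //; do 2?case: ifP.
Qed.

Lemma word_perm_out w x : word_bounded n w -> x \notin pts -> word_perm w x = x.
Proof.
rewrite /word_perm => wb xp; elim: w wb => [|ij w IH] /=.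
  by rewrite big_nil perm1.
case/andP=> /andP[i_n j_n] wb; rewrite big_cons permM tpermD ?IH //.
- by apply: contraNneq xp => <-; rewrite mem_nth.
- by apply: contraNneq xp => <-; rewrite mem_nth.
Qed.

Lemma word_perm_table w w' : word_bounded n w -> word_bounded n w' ->
  word_table n w = word_table n w' -> word_perm w = word_perm w'.
Proof.
move=> wb wb' /eq_in_map E; apply/permP => x.
have [xp|xp] := boolP (x \in pts); last by rewrite !word_perm_out.
have xn : (index x pts < n)%N by rewrite index_mem.
by rewrite -(nth_index x0 xp) !word_permE // E // mem_iota.
Qed.

Lemma table_coefE L c : table_coef (form_tables n L) c
  = \sum_(t <- L | word_table n t.2 == c) t.1.
Proof. by elim: L => [|t L IH]; rewrite ?big_nil //= big_cons IH. Qed.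

Lemma form_null_eval L : form_null n L -> form_eval L = 0.
Proof.
case/andP=> /allP Lb /allP L0; rewrite /form_eval.
have unzipE : unzip1 (form_tables n L) = [seq word_table n t.2 | t <- L].
  by rewrite /unzip1 -map_comp.
rewrite unzipE in L0.
pose tables := undup [seq word_table n t.2 | t <- L].
have tablesP t : t \in L -> word_table n t.2 \in tables.
  by move=> tL; rewrite mem_undup (map_f (fun t => word_table n t.2)).
transitivity (\sum_(t <- L) \sum_(c <- tables | word_table n t.2 == c)
    t.1%:~R * corr f (word_perm t.2)).
  rewrite big_seq [RHS]big_seq; apply: eq_bigr => t tL.
  rewrite -big_filter (_ : filter _ _ = [:: word_table n t.2]) ?big_seq1 //.
  rewrite (eq_filter (a2 := pred1 (word_table n t.2))); last first.
    by move=> c; rewrite /= eq_sym.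
  by rewrite filter_pred1_uniq ?undup_uniq ?tablesP.
rewrite (exchange_big_dep predT) //= big1_seq // => c /andP[_ cL].
have [t0 t0L def_c] : exists2 t0, t0 \in L & c = word_table n t0.2.
  by move: cL; rewrite mem_undup => /mapP[t0 ? ->]; exists t0.
transitivity (\sum_(t <- L | word_table n t.2 == c)
    t.1%:~R * corr f (word_perm t0.2)).
  rewrite big_seq_cond [RHS]big_seq_cond; apply: eq_bigr => t /andP[tL /eqP tc].
  by rewrite (@word_perm_table t.2 t0.2) ?tc // Lb.
have := L0 c cL; rewrite table_coefE -mulr_suml -rmorph_sum => /eqP-> /=.
by rewrite mul0r.
Qed.

Lemma form_eval_cat L L' : form_eval (L ++ L') = form_eval L + form_eval L'.
Proof. exact: big_cat. Qed.

Lemma form_eval_rev L : form_eval (form_rev L) = form_eval L.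
Proof.
rewrite /form_eval big_map; apply: eq_bigr => t _ /=.
by rewrite word_perm_rev corrV.
Qed.

Lemma form_eval_scale a L : form_eval (form_scale a L) = a%:~R * form_eval L.
Proof.
rewrite /form_eval big_map mulr_sumr; apply: eq_bigr => t _ /=.
by rewrite intrM mulrA.
Qed.

Lemma form_eval_square_ge0 L : 0 <= form_eval (form_square L).
Proof.
rewrite /form_eval big_flatten big_map /=; under eq_bigr do rewrite big_map /=.
under eq_bigr do under eq_bigr do rewrite intrM word_perm_cat word_perm_rev.
rewrite (corr_gram f L (fun t => t.1%:~R) (fun t => word_perm t.2)).
by apply: sumr_ge0 => s _; apply: sqr_ge0.
Qed.

Lemma form_projective_ge0 m L : form_projective n m L -> 0 <= form_eval L.
Proof.
move/form_null_eval; rewrite form_eval_cat form_eval_scale => /eqP.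
rewrite mulrNz mulNr subr_eq0 => /eqP sqE.
have := form_eval_square_ge0 (L ++ form_rev L).
rewrite sqE pmulr_rge0 ?ltr0z // form_eval_cat form_eval_rev; lra.
Qed.

End Forms.

(** Adding the adjoint, in which 3-cycles are inverted, gives
    2 (sum over the Klein four-group) - (sum of the eight 3-cycles), which is 12
    times the difference of the averages over the Klein four-group and over the
    alternating group. *)
Definition klein_form (x y z u : nat) : form :=
  [:: (1, [::]); (1, [:: (x, y); (z, u)]); (1, [:: (x, z); (y, u)]);
      (1, [:: (x, u); (y, z)]); (-1, [:: (x, y); (y, z)]);
      (-1, [:: (x, y); (y, u)]); (-1, [:: (x, z); (z, u)]);
      (-1, [:: (y, z); (z, u)])].

(** The sum of the four Klein forms on points including 0, minus the Klein form
    on 1, 2, 3, 4, with equal words collected to keep the computation small. *)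
Definition klein5_form : form :=
  (3, [::]) ::
  [seq (-1 : int, w) | w <- [::
   [:: (1, 2); (3, 4)]; [:: (1, 3); (2, 4)]; [:: (1, 4); (2, 3)]]]
 ++ [seq (1 : int, w) | w <- [::
   [:: (0, 1); (2, 3)]; [:: (0, 2); (1, 3)]; [:: (0, 3); (1, 2)];
   [:: (0, 1); (2, 4)]; [:: (0, 2); (1, 4)]; [:: (0, 4); (1, 2)];
   [:: (0, 1); (3, 4)]; [:: (0, 3); (1, 4)]; [:: (0, 4); (1, 3)];
   [:: (0, 2); (3, 4)]; [:: (0, 3); (2, 4)]; [:: (0, 4); (2, 3)]]]
 ++ [seq (-2 : int, w) | w <- [::
   [:: (0, 1); (1, 2)]; [:: (0, 1); (1, 3)]; [:: (0, 1); (1, 4)];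
   [:: (0, 2); (2, 3)]; [:: (0, 2); (2, 4)]; [:: (0, 3); (3, 4)]]].

Lemma klein_projective : form_projective 4 11 (klein_form 0 1 2 3).
Proof. by vm_compute. Qed.

Lemma klein5_projective : form_projective 5 23 klein5_form.
Proof. by vm_compute. Qed.

(** * Weighted sums over quadruples *)

Section FourfoldSums.
Variables (R : realFieldType) (T : finType).
Implicit Types (a b c d : T -> R) (F G : T -> T -> T -> T -> R).

Definition sum4 a b c d F : R :=
  \sum_x \sum_y \sum_z \sum_u a x * b y * c z * d u * F x y z u.

Lemma eq_sum4 a b c d F G : (forall x y z u, F x y z u = G x y z u) ->
  sum4 a b c d F = sum4 a b c d G.
Proof. by move=> E; do 4!apply: eq_bigr => ? _; rewrite E. Qed.

Lemma sum4D a b c d F G : sum4 a b c d (fun x y z u => F x y z u + G x y z u)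
  = sum4 a b c d F + sum4 a b c d G.
Proof.
rewrite /sum4; do 4!(rewrite -big_split; apply: eq_bigr => ? _).
by rewrite mulrDr.
Qed.

Lemma sum4Z a b c d k F :
  sum4 a b c d (fun x y z u => k * F x y z u) = k * sum4 a b c d F.
Proof.
rewrite /sum4; do 4!(rewrite mulr_sumr; apply: eq_bigr => ? _).
by rewrite mulrCA.
Qed.

Lemma sum4_swap12 a b c d F :
  sum4 a b c d F = sum4 b a c d (fun x y z u => F y x z u).
Proof.
rewrite /sum4 exchange_big; do 4!apply: eq_bigr => ? _.
by congr (_ * _ * _ * _); rewrite mulrC.
Qed.

Lemma sum4_swap23 a b c d F :
  sum4 a b c d F = sum4 a c b d (fun x y z u => F x z y u).
Proof.
rewrite /sum4; apply: eq_bigr => ? _; rewrite exchange_big.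
by do 3!apply: eq_bigr => ? _; congr (_ * _ * _); rewrite mulrAC.
Qed.

Lemma sum4_swap34 a b c d F :
  sum4 a b c d F = sum4 a b d c (fun x y z u => F x y u z).
Proof.
rewrite /sum4; do 2!apply: eq_bigr => ? _; rewrite exchange_big.
by do 2!apply: eq_bigr => ? _; congr (_ * _); rewrite mulrAC.
Qed.

Lemma sum4_const1 a b c d (G : T -> T -> T -> R) :
  sum4 a b c d (fun _ y z u => G y z u)
  = (\sum_x a x) * \sum_y \sum_z \sum_u b y * c z * d u * G y z u.
Proof.
rewrite mulr_suml; apply: eq_bigr => x _.
by do 3!(rewrite mulr_sumr; apply: eq_bigr => ? _); rewrite !mulrA.
Qed.

Lemma sum4_le0 a F : (forall x, 0 <= a x) ->
  (forall x y z u, a x * a y * a z * a u != 0 -> F x y z u <= 0) ->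
  sum4 a a a a F <= 0.
Proof.
move=> a_ge0 F_le0; rewrite /sum4; apply: sumr_le0 => x _; apply: sumr_le0 => y _.
apply: sumr_le0 => z _; apply: sumr_le0 => u _.
have [->|nz] := eqVneq (a x * a y * a z * a u) 0; first by rewrite mul0r.
by rewrite mulr_ge0_le0 ?mulr_ge0 ?F_le0.
Qed.

End FourfoldSums.

(** * The Klein defect of four points *)

Section Klein.
Variables (R : realFieldType) (T : finType) (phi : {perm T} -> R).
Hypothesis phiV : forall s, phi s^-1%g = phi s.
Implicit Types (x y z u v o : T).

Definition corr3 x y z : R := phi (tperm x y * tperm y z)%g.

(** When phi is the correlation of f and the points are distinct, this is
    6 <f, Pi f>, where Pi is the projection on the vectors fixed by the Klein
    four-group and orthogonal to those fixed by the alternating group; each pair of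
    inverse 3-cycles is counted once. *)
Definition klein x y z u : R :=
  if uniq [:: x; y; z; u] then
    phi 1%g + phi (tperm x y * tperm z u)%g + phi (tperm x z * tperm y u)%g
    + phi (tperm x u * tperm y z)%g
    - (corr3 x y z + corr3 x y u + corr3 x z u + corr3 y z u)
  else 0.

Lemma klein_not_uniq x y z u : ~~ uniq [:: x; y; z; u] -> klein x y z u = 0.
Proof. by rewrite /klein => /negbTE->. Qed.

Lemma corr3_rev x y z : corr3 z y x = corr3 x y z.
Proof. by rewrite /corr3 -phiV invMg !tpermV (tpermC y x) (tpermC z y). Qed.

Lemma corr3_rot x y z : x != y -> x != z -> corr3 y z x = corr3 x y z.
Proof.
move=> xy xz; rewrite /corr3; congr (phi _).
by rewrite [RHS]conjgC tpermJ tpermL tpermD 1?eq_sym // (tpermC x).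
Qed.

Lemma corr3_swap x y z : x != y -> y != z -> x != z -> corr3 y x z = corr3 x y z.
Proof. move=> xy yz xz.
by rewrite -(corr3_rev y x z) (@corr3_rot y z x) ?(eq_sym y x) // corr3_rot. Qed.

Lemma corr3_swap23 x y z : x != y -> x != z -> corr3 x z y = corr3 x y z.
Proof.
move=> xy xz.
by rewrite -corr3_rev -(corr3_rot xy xz) corr3_rev corr3_rev corr3_rot.
Qed.

Lemma corr_tperm2C x y z u :
  phi (tperm z u * tperm x y)%g = phi (tperm x y * tperm z u)%g.
Proof. by rewrite -phiV invMg !tpermV. Qed.

Lemma klein_swap12 x y z u : klein y x z u = klein x y z u.
Proof.
rewrite /klein /= !inE !negb_or (eq_sym y x).
case: ifP => [/andP[/and3P[xy yz yu] /and3P[/andP[xz xu] zu _]]|nu]; last first.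
  by rewrite ifF //; apply: contraFF nu; do 3?case: (_ != _).
rewrite xy yz yu xz xu zu /= (corr3_swap xy yz xz) (corr3_swap xy yu xu).
rewrite (tpermC y x) (corr_tperm2C x z) (corr_tperm2C x u); ring.
Qed.

Lemma klein_swap23 x y z u : klein x z y u = klein x y z u.
Proof.
rewrite /klein /= !inE !negb_or (eq_sym z y).
case: ifP => [/andP[/and3P[xz xy xu] /and3P[/andP[yz zu] yu _]]|nu]; last first.
  by rewrite ifF //; apply: contraFF nu; do 5?case: (_ != _).
rewrite xy xz xu yz yu zu /= (corr3_swap23 xy xz) (corr3_swap yz zu yu).
rewrite (tpermC z y); ring.
Qed.

Lemma klein_swap34 x y z u : klein x y u z = klein x y z u.
Proof.
rewrite /klein /= !inE !negb_or (eq_sym u z).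
case: ifP => [/andP[/and3P[xy xu xz] /and3P[/andP[yu yz] zu _]]|nu]; last first.
  by rewrite ifF //; apply: contraFF nu; do 6?case: (_ != _).
rewrite xy xz xu yz yu zu /= (corr3_swap23 xz xu) (corr3_swap23 yz yu).
rewrite (tpermC u z); ring.
Qed.

Lemma corr_tperm3 x y z : x != y -> y != z -> x != z ->
  (phi (tperm y z * tperm x y)%g = corr3 x y z) *
  (phi (tperm x y * tperm y z)%g = corr3 x y z) *
  (phi (tperm x y * tperm x z)%g = corr3 x y z) *
  (phi (tperm x z * tperm x y)%g = corr3 x y z) *
  (phi (tperm x z * tperm y z)%g = corr3 x y z) *
  (phi (tperm y z * tperm x z)%g = corr3 x y z).
Proof.
move=> xy yz xz.
have E1 : phi (tperm x y * tperm x z)%g = corr3 x y z.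
  by rewrite (tpermC x y) -/(corr3 y x z) corr3_swap.
have E2 : phi (tperm x z * tperm y z)%g = corr3 x y z.
  by rewrite (tpermC y z) -/(corr3 x z y) corr3_swap23.
by rewrite !(corr_tperm2C _ _ y z) !(corr_tperm2C x y x z) E1 E2.
Qed.

(** The part of the symmetrised product tau_xy tau_zu that only depends on three
    points; it disappears under weights of sum 0.  Its values on coinciding points
    are the ones that make the next identity hold for all quadruples. *)
Definition octopus_rest x y z : R :=
  if uniq [:: x; y; z] then corr3 x y z - phi 1%g / 4
  else if (x == y) && (y == z) then - (3 / 4 * phi 1%g) else phi 1%g / 4.

(** Symmetrising over the three pairings of four points makes the product of two
    transpositions symmetric.  For distinct points the double transpositions are,
    by definition of the Klein defect, equal to it up to 3-cycles and the identity,
    which involve at most three of the points.  The sum of the diagonal terms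
    accounts for the quadruples with coincidences. *)
Lemma pairings_identity x y z u :
  phi (tperm x y * tperm z u)%g + phi (tperm x z * tperm y u)%g
  + phi (tperm x u * tperm y z)%g
  - ((x == y)%:R * phi (tperm z u) + (z == u)%:R * phi (tperm x y)
   + (x == z)%:R * phi (tperm y u) + (y == u)%:R * phi (tperm x z)
   + (x == u)%:R * phi (tperm y z) + (y == z)%:R * phi (tperm x u))
  - klein x y z u
  = octopus_rest y z u + octopus_rest x z u + octopus_rest x y u + octopus_rest x y z.
Proof.
rewrite /klein /octopus_rest /= !inE !negb_or.
(* The consistent equality patterns are the 15 partitions of four points; the
   other combinations of equalities are contradictory. *)
have [xy|xy] := eqVneq x y; have [xz|xz] := eqVneq x z; have [xu|xu] := eqVneq x u;
 have [yz|yz] := eqVneq y z; have [yu|yu] := eqVneq y u; have [zu|zu] := eqVneq z u;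
 subst; try match goal with H : is_true (?a != ?a) |- _ => by rewrite eqxx in H end.
all: rewrite /= ?tperm1 ?mulg1 ?mul1g ?tperm2.
all: rewrite /corr3; try field.
all: try match goal with H1 : is_true (?a != ?b), H2 : is_true (?b != ?c),
  H3 : is_true (?a != ?c) |- _ => rewrite ?(tpermC b a) ?(tpermC c a) ?(tpermC c b)
    ?(corr_tperm3 H1 H2 H3) end.
all: try field.
all: try (match goal with H1 : is_true (?a != ?b) |- _ =>
  rewrite ?(tpermC b a) ?tperm2 end; field).
all: by [].
Qed.

End Klein.

(** * The octopus inequality *)

Section Octopus.
Variables (R : realFieldType) (T : finType) (f : {perm T} -> R).
Implicit Types (x y z u v o : T).
Local Notation phi := (corr f).
Local Notation kappa := (klein (corr f)).
Local Notation octopus_rest := (octopus_rest phi).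

Lemma klein_ge0 x y z u : 0 <= kappa x y z u.
Proof.
rewrite /klein; case: ifP => // U.
suff <- : form_eval f x [:: x; y; z; u] (klein_form 0 1 2 3) =
  phi 1%g + phi (tperm x y * tperm z u)%g + phi (tperm x z * tperm y u)%g
    + phi (tperm x u * tperm y z)%g
    - (corr3 phi x y z + corr3 phi x y u + corr3 phi x z u + corr3 phi y z u).
  by apply: (form_projective_ge0 f x U klein_projective).
rewrite /form_eval /word_perm !big_cons !big_nil /= !mulg1 /corr3; ring.
Qed.

(** Among five distinct points, the five projections add up to 2 P, where P projects on the
    irreducible components of S_5 whose restriction to S_4 contains the
    two-dimensional representation.  Hence the difference of the two sides is a
    multiple of the projection P - Pi_xyzu. *)
Lemma klein_octopus o x y z u :
  o != x -> o != y -> o != z -> o != u ->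
  kappa x y z u <= kappa o y z u + kappa o x z u + kappa o x y u + kappa o x y z.
Proof.
move=> ox oy oz ou.
have [U|/klein_not_uniq->] := boolP (uniq [:: x; y; z; u]); last first.
  by rewrite !addr_ge0 ?klein_ge0.
have U5 : uniq [:: o; x; y; z; u].
  by rewrite cons_uniq U !inE !negb_or ox oy oz ou.
have := form_projective_ge0 f o U5 klein5_projective.
rewrite /form_eval /word_perm !big_cons !big_nil /= !mulg1.
move: U; rewrite /klein /= !inE !negb_or ox oy oz ou.
case/andP=> /and3P[xy xz xu] /and3P[/andP[yz yu] zu _].
rewrite xy xz xu yz yu zu /= /corr3; lra.
Qed.

Section ZeroSum.
Variable d : T -> R.
Hypothesis d_sum0 : \sum_x d x = 0.
Let D2 : R := \sum_x d x ^+ 2.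
Let w : R := \sum_x \sum_y d x * d y * phi (tperm x y).

Let sum4d := sum4 d d d d.

Lemma sum4_products_ge0 :
  0 <= sum4d (fun x y z u => phi (tperm x y * tperm z u)%g).
Proof.
have E := corr_gram f (index_enum _) (fun p : T * T => d p.1 * d p.2)
                      (fun p => tperm p.1 p.2).
suff -> : sum4d (fun x y z u => phi (tperm x y * tperm z u)%g)
  = \sum_(sigma : {perm T})
      (\sum_(p : T * T) d p.1 * d p.2 * f (tperm p.1 p.2 * sigma)%g) ^+ 2.
  by apply: sumr_ge0 => s _; apply: sqr_ge0.
rewrite -E exchange_big /sum4d /sum4 [LHS]pair_bigA /=; apply: eq_bigr => p _.
rewrite [LHS]pair_bigA /=; apply: eq_bigr => q _.
by rewrite tpermV; congr (_ * _); ring.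
Qed.

Lemma sum4_diag : sum4d (fun x y z u => (x == y)%:R * phi (tperm z u)) = D2 * w.
Proof.
rewrite /sum4d /sum4 mulr_suml; apply: eq_bigr => x _.
rewrite (bigD1 x) //= [X in _ + X]big1 ?addr0.
  rewrite mulr_sumr; apply: eq_bigr => z _; rewrite mulr_sumr.
  by apply: eq_bigr => u _; rewrite eqxx /=; ring.
move=> y yx; rewrite big1 // => z _; rewrite big1 // => u _.
by rewrite eq_sym (negbTE yx) mul0r mulr0.
Qed.

Lemma sum4_missing_variable (G : T -> T -> T -> R) :
  [/\ sum4d (fun _ y z u => G y z u) = 0, sum4d (fun x _ z u => G x z u) = 0,
      sum4d (fun x y _ u => G x y u) = 0 & sum4d (fun x y z _ => G x y z) = 0].
Proof.
have G1 : sum4d (fun _ y z u => G y z u) = 0.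
  by rewrite /sum4d sum4_const1 d_sum0 mul0r.
have G2 : sum4d (fun x _ z u => G x z u) = 0 by rewrite /sum4d sum4_swap12.
have G3 : sum4d (fun x y _ u => G x y u) = 0 by rewrite /sum4d sum4_swap23.
by split=> //; rewrite /sum4d sum4_swap34.
Qed.

(** Both sides are the correlations of the identity
    6 (sum_x d_x^2) W = 3 W^2 - (Klein defect) for W = sum_(x, y) d_x d_y tau_xy. *)
Lemma sum4_klein : 6 * D2 * w
  = 3 * sum4d (fun x y z u => phi (tperm x y * tperm z u)%g)
    - sum4d (fun x y z u => kappa x y z u).
Proof.
set P1 := sum4d _; set K := sum4d _.
have P2 : sum4d (fun x y z u => phi (tperm x z * tperm y u)%g) = P1.
  by rewrite /sum4d sum4_swap23.
have P3 : sum4d (fun x y z u => phi (tperm x u * tperm y z)%g) = P1.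
  by rewrite /sum4d sum4_swap34.
have Q1 := sum4_diag.
have Q3 : sum4d (fun x y z u => (x == z)%:R * phi (tperm y u)) = D2 * w.
  by rewrite /sum4d sum4_swap23.
have Q5 : sum4d (fun x y z u => (x == u)%:R * phi (tperm y z)) = D2 * w.
  by rewrite /sum4d sum4_swap34.
have Q6 : sum4d (fun x y z u => (y == z)%:R * phi (tperm x u)) = D2 * w.
  by rewrite /sum4d sum4_swap12.
have Q4 : sum4d (fun x y z u => (y == u)%:R * phi (tperm x z)) = D2 * w.
  by rewrite /sum4d sum4_swap34.
have Q2 : sum4d (fun x y z u => (z == u)%:R * phi (tperm x y)) = D2 * w.
  by rewrite /sum4d sum4_swap23.
have [G1 G2 G3 G4] := sum4_missing_variable octopus_rest.
have : sum4d (fun x y z u => phi (tperm x y * tperm z u)%g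
    + phi (tperm x z * tperm y u)%g + phi (tperm x u * tperm y z)%g)
  = sum4d (fun x y z u => ((x == y)%:R * phi (tperm z u)
      + (z == u)%:R * phi (tperm x y) + (x == z)%:R * phi (tperm y u)
      + (y == u)%:R * phi (tperm x z) + (x == u)%:R * phi (tperm y z)
      + (y == z)%:R * phi (tperm x u)) + kappa x y z u
      + (octopus_rest y z u + octopus_rest x z u + octopus_rest x y u
         + octopus_rest x y z)).
  by apply: eq_sum4 => x y z u; rewrite -(pairings_identity (corrV f)); ring.
rewrite /sum4d !sum4D -!/(sum4d _) P2 P3 Q1 Q2 Q3 Q4 Q5 Q6 G1 G2 G3 G4 -/P1 -/K.
lra.
Qed.

End ZeroSum.

Lemma sum_delta o (H : T -> R) : \sum_x (x == o)%:R * H x = H o.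
Proof.
rewrite (bigD1 o) //= eqxx mul1r big1 ?addr0 // => x /negbTE->.
by rewrite mul0r.
Qed.

(** Because the Klein defect vanishes on coinciding points, only the terms with o
    in at most one position survive.  There the weight - sum_v e_v of o is spread
    over a fourth vertex v, and the inequality between the projections applies to
    every quadruple away from o. *)
Lemma sum4_klein_le0 o (e d : T -> R) :
  (forall x, 0 <= e x) -> e o = 0 ->
  (forall x, d x = e x - (\sum_x e x) * (x == o)%:R) ->
  sum4 d d d d (fun x y z u => kappa x y z u) <= 0.
Proof.
move=> e_ge0 eo0; set C := \sum_x e x => dE; pose dl x : R := (x == o)%:R.
have dl1 : \sum_x dl x = 1.
  by rewrite -[RHS](sum_delta o (fun=> 1)); apply: eq_bigr => x _; rewrite mulr1.
have E1 : C * sum4 dl e e e (fun _ y z u => kappa o y z u)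
    = sum4 e e e e (fun _ y z u => kappa o y z u).
  by rewrite !sum4_const1 dl1 mul1r.
have E2 : C * sum4 e dl e e (fun x _ z u => kappa o x z u)
    = sum4 e e e e (fun x _ z u => kappa o x z u).
  by rewrite sum4_swap12 E1 [RHS]sum4_swap12.
have E3 : C * sum4 e e dl e (fun x y _ u => kappa o x y u)
    = sum4 e e e e (fun x y _ u => kappa o x y u).
  by rewrite sum4_swap23 E2 [RHS]sum4_swap23.
have E4 : C * sum4 e e e dl (fun x y z _ => kappa o x y z)
    = sum4 e e e e (fun x y z _ => kappa o x y z).
  by rewrite sum4_swap34 E3 [RHS]sum4_swap34.
have expand x y z u : d x * d y * d z * d u * kappa x y z u
  = e x * e y * e z * e u * kappa x y z u
    - C * (dl x * e y * e z * e u * kappa o y z u)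
    - C * (e x * dl y * e z * e u * kappa o x z u)
    - C * (e x * e y * dl z * e u * kappa o x y u)
    - C * (e x * e y * e z * dl u * kappa o x y z).
  have klC : ((forall a b, kappa o o a b = 0) * (forall a b, kappa o a o b = 0) *
     (forall a b, kappa o a b o = 0) * (forall a b, kappa a o o b = 0) *
     (forall a b, kappa a o b o = 0) * (forall a b, kappa a b o o = 0))%type.
    by do !split=> *; apply: klein_not_uniq; rewrite /= !inE eqxx ?orbT ?andbF.
  rewrite !dE /dl; have [->|xo] := eqVneq x o; have [->|yo] := eqVneq y o;
    have [->|zo] := eqVneq z o; have [->|uo] := eqVneq u o;
    rewrite ?eo0 ?klC /=; try ring.
  - by rewrite (klein_swap12 (corrV f) o x); ring.
  - by rewrite (klein_swap23 (corrV f) x o) (klein_swap12 (corrV f) o x); ring.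
  - rewrite (klein_swap34 (corrV f) x y o) (klein_swap23 (corrV f) x o).
    by rewrite (klein_swap12 (corrV f) o x); ring.
have -> : sum4 d d d d (fun x y z u => kappa x y z u)
  = sum4 e e e e (fun x y z u => kappa x y z u - (kappa o y z u + kappa o x z u
      + kappa o x y u + kappa o x y z)).
  transitivity (sum4 e e e e (fun x y z u => kappa x y z u)
    - C * sum4 dl e e e (fun _ y z u => kappa o y z u)
    - C * sum4 e dl e e (fun x _ z u => kappa o x z u)
    - C * sum4 e e dl e (fun x y _ u => kappa o x y u)
    - C * sum4 e e e dl (fun x y z _ => kappa o x y z)); last first.
    rewrite E1 E2 E3 E4.
    under [RHS]eq_sum4 do rewrite -mulN1r.
    by rewrite sum4D sum4Z !sum4D; ring.
  rewrite /sum4 !mulr_sumr -!sumrB; apply: eq_bigr => x _.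
  rewrite !mulr_sumr -!sumrB; apply: eq_bigr => y _.
  rewrite !mulr_sumr -!sumrB; apply: eq_bigr => z _.
  by rewrite !mulr_sumr -!sumrB; apply: eq_bigr => u _; rewrite expand.
apply: sum4_le0 => // x y z u.
rewrite !mulf_eq0 !negb_or => /andP[/andP[/andP[ex ey] ez] eu].
have no v : e v != 0 -> o != v by apply: contra_neq => <-.
by rewrite subr_le0 klein_octopus ?no.
Qed.

(** The weights c, with their total mass subtracted at o, sum to 0; the inequality
    says that W is nonnegative for these weights, since the energies are
    2 (phi 1 - phi tau). *)
Lemma octopus o (c : T -> R) : (forall x, 0 <= c x) ->
  \sum_y \sum_z c y * c z * energy f y z
  <= 2 * (\sum_y c y) * \sum_y c y * energy f o y.
Proof.
move=> c_ge0; pose K := \sum_y c y.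
pose e x := if x == o then 0 else c x.
pose d x := c x - K * (x == o)%:R.
have cE x : c x = e x + c o * (x == o)%:R.
  by rewrite /e; case: eqP => [->|_]; rewrite ?mulr1 ?mulr0 ?add0r ?addr0.
have KE : K = \sum_x e x + c o.
  rewrite /K; under eq_bigr do rewrite cE mulrC.
  by rewrite big_split /= sum_delta.
have dE x : d x = e x - (\sum_x e x) * (x == o)%:R by rewrite /d cE KE; ring.
have d0 : \sum_x d x = 0.
  rewrite /d sumrB; under [X in _ - X]eq_bigr do rewrite mulrC.
  by rewrite sum_delta subrr.
have K_le0 : sum4 d d d d (fun x y z u => kappa x y z u) <= 0.
  apply: (@sum4_klein_le0 o e) => // [x|]; last by rewrite /e eqxx.
  by rewrite /e; case: ifP.
pose w := \sum_x \sum_y d x * d y * phi (tperm x y).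
have w_ge0 : 0 <= w.
  have := sum4_klein d0; have := sum4_products_ge0 d; rewrite -/w.
  have D2_ge0 : 0 <= \sum_x d x ^+ 2 by apply: sumr_ge0 => x _; apply: sqr_ge0.
  have [/eqP D20|D2n0] := eqVneq (\sum_x d x ^+ 2) 0.
    suff -> : w = 0 by [].
    rewrite /w big1 // => x _; rewrite big1 // => y _.
    move: D20; rewrite psumr_eq0; last by move=> *; apply: sqr_ge0.
    by move=> /allP/(_ x (mem_index_enum _)); rewrite sqrf_eq0 => /eqP->; rewrite !mul0r.
  move=> P_ge0 E; rewrite -(@pmulr_rge0 _ (6 * \sum_x d x ^+ 2)).
    by rewrite E; lra.
  by rewrite mulr_gt0 ?ltr0n // lt_def D2n0.
have E : \sum_x \sum_y d x * d y * energy f x y = - (2 * w).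
  transitivity (\sum_x (d x * (\sum_y d y) * (2 * phi 1%g)
    - 2 * \sum_y d x * d y * phi (tperm x y))).
    apply: eq_bigr => x _; rewrite [d x * _]mulr_sumr mulr_suml.
    rewrite [X in _ - X]mulr_sumr -sumrB.
    by apply: eq_bigr => y _; rewrite energyE; ring.
  by rewrite sumrB -mulr_sumr d0 big1 ?sub0r // => x _; rewrite mulr0 mul0r.
have : \sum_x \sum_y d x * d y * energy f x y
  = \sum_y \sum_z c y * c z * energy f y z - 2 * K * \sum_y c y * energy f o y.
  transitivity (\sum_x (\sum_y c x * c y * energy f x y
     - K * (c x * energy f o x)
     - (x == o)%:R * \sum_y (K * (c y * energy f x y)
          - (y == o)%:R * (K * K * energy f x y)))).
    apply: eq_bigr => x _.
    transitivity (\sum_y (c x * c y * energy f x y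
       - (y == o)%:R * (K * (c x * energy f x y))
       - (x == o)%:R * (K * (c y * energy f x y)
          - (y == o)%:R * (K * K * energy f x y)))).
      by apply: eq_bigr => y _; rewrite /d; ring.
    by rewrite !sumrB sum_delta -mulr_sumr sumrB (energyC f o).
  rewrite !sumrB sum_delta sumrB sum_delta energyxx -!mulr_sumr; ring.
rewrite E -/K; lra.
Qed.

End Octopus.

(** * Averaging over a symmetric kernel *)

Section KernelEnergy.
Variables (R : realFieldType) (T : finType) (f : {perm T} -> R).

Definition kernel_energy (P : T -> T -> R) : R :=
  \sum_x \sum_y P x y * energy f x y.

(** The octopus inequality around o with weights P o, summed over o: two
    independent steps from o connect y to z with rates given by the square of P. *)
Lemma kernel_energy_square (P : T -> T -> R) :
  (forall x y, 0 <= P x y) -> (forall x y, P x y = P y x) ->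
  (forall x, \sum_y P x y = 1) ->
  kernel_energy (fun x y => \sum_z P x z * P z y) <= 2 * kernel_energy P.
Proof.
move=> P_ge0 P_sym P_sum1.
have -> : kernel_energy (fun x y => \sum_z P x z * P z y)
  = \sum_o \sum_y \sum_z P o y * P o z * energy f y z.
  rewrite [RHS]exchange_big; apply: eq_bigr => x _.
  rewrite exchange_big; apply: eq_bigr => y _ /=.
  by rewrite mulr_suml; apply: eq_bigr => z _; rewrite (P_sym z x).
rewrite /kernel_energy mulr_sumr; apply: ler_sum => o _.
by have := octopus f o (P_ge0 o); rewrite P_sum1 mulr1.
Qed.

End KernelEnergy.

(** * The noise kernel on a product *)

Section Products.
Variables (R : rcfType) (l n : nat).
Hypothesis l_gt0 : (0 < l)%N.
Local Notation V := {ffun 'I_n -> 'I_l}.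
Implicit Types (x y z : V) (r : R) (i : 'I_n) (a b : 'I_l).

Definition upd x i a : V := [ffun j => if j == i then a else x j].

Definition noise1 r a b : R := r * (a == b)%:R + (1 - r) / l%:R.
Definition noise r x y : R := \prod_i noise1 r (x i) (y i).

Let l_neq0 : l%:R != 0 :> R.
Proof. by rewrite pnatr_eq0 -lt0n. Qed.

Lemma sum_prod_ffun (F : 'I_n -> 'I_l -> R) :
  \sum_(x : V) \prod_i F i (x i) = \prod_i \sum_a F i a.
Proof. by rewrite bigA_distr_bigA. Qed.

Lemma noise1_sum r a : \sum_b noise1 r a b = 1.
Proof.
rewrite big_split /= sumr_const card_ord.
under eq_bigr do rewrite mulrC eq_sym.
rewrite sum_delta -mulr_natr; field.
by [].
Qed.

Lemma noise1_square r a b :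
  \sum_c noise1 r a c * noise1 r c b = noise1 (r ^+ 2) a b.
Proof.
transitivity (\sum_c ((c == a)%:R * (r ^+ 2 * (c == b)%:R + r * ((1 - r) / l%:R))
     + (c == b)%:R * (r * ((1 - r) / l%:R)) + ((1 - r) / l%:R) ^+ 2)).
  by apply: eq_bigr => c _; rewrite /noise1 (eq_sym a c); ring.
rewrite !big_split /= !sum_delta sumr_const card_ord -mulr_natr /noise1; field.
by [].
Qed.

Lemma noise1_ge0 r a b : 0 <= r <= 1 -> 0 <= noise1 r a b.
Proof.
by case/andP=> r0 r1; rewrite addr_ge0 ?mulr_ge0 ?invr_ge0 ?subr_ge0 ?ler0n.
Qed.

Lemma noise_ge0 r x y : 0 <= r <= 1 -> 0 <= noise r x y.
Proof. by move=> r01; apply: prodr_ge0 => i _; apply: noise1_ge0. Qed.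

Lemma noise_sym r x y : noise r x y = noise r y x.
Proof. by apply: eq_bigr => i _; rewrite /noise1 eq_sym. Qed.

Lemma noise_sum r x : \sum_y noise r x y = 1.
Proof.
rewrite (sum_prod_ffun (fun i b => noise1 r (x i) b)).
by rewrite big1 // => i _; apply: noise1_sum.
Qed.

Lemma noise_square r x y : \sum_z noise r x z * noise r z y = noise (r ^+ 2) x y.
Proof.
under eq_bigr do rewrite -big_split.
rewrite (sum_prod_ffun (fun i c => noise1 r (x i) c * noise1 r c (y i))).
by apply: eq_bigr => i _; apply: noise1_square.
Qed.

Lemma noise1_neq_le r a b : 0 <= r <= 1 -> a != b -> noise1 r a b <= 1 - r.
Proof.
case/andP=> r0 r1 /negbTE ab; rewrite /noise1 ab mulr0 add0r.
by rewrite ler_pdivrMr ?ltr0n // ler_peMr ?subr_ge0 // ler1n.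
Qed.

Lemma noise1_le1 r a b : 0 <= r <= 1 -> noise1 r a b <= 1.
Proof.
move=> r01; rewrite -(noise1_sum r a) (bigD1 b) //= lerDl.
by apply: sumr_ge0 => c _; apply: noise1_ge0.
Qed.

(** Each redrawn coordinate costs a factor 1 - r, and points that differ in one
    coordinate only lie on a common line. *)
Lemma noise_le r x y : 0 <= r <= 1 -> x != y ->
  noise r x y <= (1 - r) * (\sum_i \sum_b (y == upd x i b)%:R) + (1 - r) ^+ 2.
Proof.
move=> r01 xy; have /andP[r0 r1] := r01.
have prod_le1 (P : pred 'I_n) : \prod_(i | P i) noise1 r (x i) (y i) <= 1.
  by apply: prodr_ile1 => i _; rewrite noise1_ge0 ?noise1_le1.
have [i xyi] : exists i, x i != y i.
  apply/existsP; apply: contraNT xy; rewrite negb_exists => /forallP E.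
  by apply/eqP/ffunP => i; apply/eqP; have := E i; rewrite negbK.
(* One differing coordinate against at least two. *)
rewrite /noise (bigD1 i) //=; have [/eqP yE|yNE] := boolP (y == upd x i (y i)).
  apply: (@le_trans _ _ (1 - r)).
    rewrite -[leRHS]mulr1 ler_pM ?noise1_ge0 ?noise1_neq_le //.
    by apply: prodr_ge0 => j _; apply: noise1_ge0.
  rewrite ler_wpDr ?sqr_ge0 // ler_peMr ?subr_ge0 //.
  rewrite (bigD1 i) //= (bigD1 (y i)) //= -yE eqxx -addrA lerDl.
  by rewrite addr_ge0 // ?sumr_ge0 // => j _; rewrite sumr_ge0.
have [j ji xyj] : exists2 j, j != i & x j != y j.
  apply/exists_inP; apply: contraNT yNE; rewrite negb_exists_in => /forall_inP E.
  apply/eqP/ffunP => j; rewrite ffunE; case: eqP => [->//|/eqP ji].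
  by apply/esym/eqP; have := E j ji; rewrite negbK.
rewrite (bigD1 j) //=; apply: (@le_trans _ _ ((1 - r) ^+ 2)); last first.
  rewrite lerDr mulr_ge0 ?subr_ge0 // sumr_ge0 // => k _; exact: sumr_ge0.
rewrite expr2 ler_pM ?noise1_ge0 ?noise1_neq_le //.
  rewrite mulr_ge0 ?noise1_ge0 //; apply: prodr_ge0 => k _; exact: noise1_ge0.
rewrite -[leRHS]mulr1 ler_pM ?noise1_ge0 ?noise1_neq_le //.
by apply: prodr_ge0 => k _; apply: noise1_ge0.
Qed.

Section Energy.
Variable f : {perm V} -> R.

Definition line_energy : R := \sum_x \sum_i \sum_b energy f x (upd x i b).
Definition total_energy : R := \sum_x \sum_y energy f x y.

Lemma line_energy_ge0 : 0 <= line_energy.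
Proof. by do 3!(apply: sumr_ge0 => ? _); apply: energy_ge0. Qed.

Lemma total_energy_ge0 : 0 <= total_energy.
Proof. by do 2!(apply: sumr_ge0 => ? _); apply: energy_ge0. Qed.

Lemma noise_energy_small r : 0 <= r <= 1 ->
  kernel_energy f (noise r)
  <= (1 - r) * line_energy + (1 - r) ^+ 2 * total_energy.
Proof.
move=> r01; rewrite /kernel_energy /line_energy /total_energy !mulr_sumr -big_split.
apply: ler_sum => x _ /=.
have -> : \sum_i \sum_b energy f x (upd x i b)
   = \sum_y (\sum_i \sum_b (y == upd x i b)%:R) * energy f x y.
  under [RHS]eq_bigr do rewrite mulr_suml.
  rewrite [RHS]exchange_big; apply: eq_bigr => i _ /=.
  under [RHS]eq_bigr do rewrite mulr_suml.
  by rewrite [RHS]exchange_big; apply: eq_bigr => b _ /=; rewrite sum_delta.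
rewrite !mulr_sumr -big_split; apply: ler_sum => y _ /=.
have [<-|xy] := eqVneq x y; first by rewrite energyxx !mulr0 addr0.
by rewrite mulrA -mulrDl ler_wpM2r ?energy_ge0 ?noise_le.
Qed.

Lemma noise_energy_double r : 0 <= r <= 1 ->
  kernel_energy f (noise (r ^+ 2)) <= 2 * kernel_energy f (noise r).
Proof.
move=> r01.
have := kernel_energy_square f (fun x y => noise_ge0 x y r01) (noise_sym r) (noise_sum r).
rewrite /kernel_energy.
by under eq_bigr do under eq_bigr do rewrite noise_square.
Qed.

(** Halving the time k times, with t = 1 / r replaced by its square root.  As
    2 (t - 1) <= t^2 - 1, the coefficient of the line energy does not grow, while
    that of the quadratic error term gains a factor 1/2 at each step. *)
Lemma noise_energy_scale k r : 0 < r <= 1 ->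
  kernel_energy f (noise r)
  <= (r^-1 - 1) * line_energy + (r^-1 - 1) ^+ 2 / 2 ^+ k * total_energy.
Proof.
have L0 := line_energy_ge0; have A0 := total_energy_ge0.
elim: k r => [|k IH] r /andP[r0 r1].
  apply: le_trans (noise_energy_small _) _; first by rewrite ltW.
  have rV : 1 - r <= r^-1 - 1.
    have := sqr_ge0 (1 - r); rewrite -(pmulr_lge0 _ r0) => _.
    have : 0 <= (1 - r) ^+ 2 / r by rewrite divr_ge0 ?sqr_ge0 ?ltW.
    rewrite (_ : _ / r = (r^-1 - 1) - (1 - r)) ?subr_ge0 //; field.
    by rewrite gt_eqF.
  rewrite divr1 lerD ?ler_wpM2r // ler_pXn2r // nnegrE ?subr_ge0 //.
  by rewrite invf_ge1.
pose s := Num.sqrt r.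
have s0 : 0 < s by rewrite sqrtr_gt0.
have sr : s ^+ 2 = r by rewrite sqr_sqrtr // ltW.
have s1 : s <= 1 by rewrite -(@expr_le1 _ 2) ?sr // ltW.
rewrite -sr; apply: le_trans (noise_energy_double _) _; first by rewrite s1 ltW.
have := IH s; rewrite s0 s1 => /(_ isT).
rewrite -[(s ^+ 2)^-1]exprVn.
set t := s^-1; have t1 : 1 <= t by rewrite invf_ge1.
have -> : 2 ^+ k.+1 = 2 * 2 ^+ k :> R by rewrite exprS.
move: (2 ^+ k) (exprn_gt0 k (ltr0n R 2)) => q q0 E.
apply: (@le_trans _ _ (2 * (t - 1) * line_energy
    + 2 * ((t - 1) ^+ 2 / q) * total_energy)).
  rewrite -[2 * (t - 1) * _]mulrA -[2 * (_ / q) * _]mulrA -mulrDr.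
  by rewrite ler_pM2l ?ltr0n.
have t2 : 2 * (t - 1) <= t ^+ 2 - 1 by have := sqr_ge0 (t - 1); nra.
rewrite lerD ?ler_wpM2r //.
rewrite (_ : 2 * _ = (2 * (t - 1)) ^+ 2 / (2 * q)); last by field; rewrite gt_eqF.
rewrite ler_wpM2r ?invr_ge0 ?mulr_ge0 ?(ltW q0) // ler_pXn2r // nnegrE.
  by rewrite mulr_ge0 ?subr_ge0.
by rewrite (le_trans _ t2) ?mulr_ge0 ?subr_ge0.
Qed.
End Energy.
End Products.

(** * From all pairs to lines *)

Section Coupling.
Variables (R : realType) (l n : nat).
Hypothesis l_gt0 : (0 < l)%N.
Local Notation V := {ffun 'I_n -> 'I_l}.
Implicit Types (x y z : V) (i : 'I_n) (a b : 'I_l).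
Variable f : {perm V} -> R.

Lemma noise_energy_le_line : kernel_energy f (noise 2^-1) <= line_energy f.
Proof.
have A0 := total_energy_ge0 f.
apply/ler_addgt0Pr => e e0.
have := archi_boundP (divr_ge0 A0 (ltW e0)).
set k := Num.bound _ => k_bound.
have half01 : (0 < 2^-1 :> R) && (2^-1 <= 1 :> R).
  by rewrite invr_gt0 ltr0n invf_le1 ?ler1n ?ltr0n.
apply: le_trans (noise_energy_scale l_gt0 f k half01) _.
rewrite invrK (_ : 2 - 1 = 1) ?mul1r; last by ring.
rewrite lerD2l expr1n mul1r mulrC ler_pdivrMr ?exprn_gt0 //.
rewrite mulrC -ler_pdivrMr //; apply: le_trans (ltW k_bound) _.
by rewrite -natrX ler_nat ltnW // ltn_expl.
Qed.

(** The conditional law of z given x and y when each coordinate of z is copied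
    from x or from y with a fair coin. *)
Definition midpoint x y z : R :=
  \prod_i (2^-1 * ((z i == x i)%:R + (z i == y i)%:R)).

Lemma midpoint_ge0 x y z : 0 <= midpoint x y z.
Proof. by apply: prodr_ge0 => i _; rewrite mulr_ge0 ?invr_ge0 ?addr_ge0. Qed.

Lemma midpointC x y z : midpoint x y z = midpoint y x z.
Proof. by apply: eq_bigr => i _; rewrite addrC. Qed.

Lemma midpoint_sum x y : \sum_z midpoint x y z = 1.
Proof.
rewrite (sum_prod_ffun (fun i c => 2^-1 * ((c == x i)%:R + (c == y i)%:R))).
rewrite big1 // => i _; rewrite -mulr_sumr big_split /=.
have d1 a : \sum_c (c == a)%:R = 1 :> R.
  by rewrite -[RHS](sum_delta a (fun=> 1)); apply: eq_bigr => c _; rewrite mulr1.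
by rewrite !d1; field.
Qed.

(** If y is uniform, copying a coordinate of y amounts to redrawing it, so z is
    one noise step of parameter 1/2 away from x. *)
Lemma midpoint_marginal x z : \sum_y midpoint x y z = l%:R ^+ n * noise 2^-1 x z.
Proof.
rewrite (sum_prod_ffun (fun i c => 2^-1 * ((z i == x i)%:R + (z i == c)%:R))).
rewrite -[in l%:R ^+ n](card_ord n) -prodr_const -big_split /=.
apply: eq_bigr => i _; rewrite -mulr_sumr big_split /= sumr_const card_ord.
have -> : \sum_c (z i == c)%:R = 1 :> R.
  rewrite -[RHS](sum_delta (z i) (fun=> 1)).
  by apply: eq_bigr => c _; rewrite mulr1 eq_sym.
rewrite /noise1 (eq_sym (x i)) -mulr_natr; field.
by rewrite pnatr_eq0 -lt0n.
Qed.

Lemma total_energy_le_noise :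
  total_energy f <= 9 * l%:R ^+ n * kernel_energy f (noise 2^-1).
Proof.
have -> : total_energy f = \sum_x \sum_y \sum_z midpoint x y z * energy f x y.
  apply: eq_bigr => x _; apply: eq_bigr => y _.
  by rewrite -mulr_suml midpoint_sum mul1r.
apply: (@le_trans _ _ (\sum_x \sum_y \sum_z
    (6 * (midpoint x y z * energy f x z) + 3 * (midpoint x y z * energy f z y)))).
  do 3!(apply: ler_sum => ? _).
  rewrite !(mulrCA _ (midpoint _ _ _)) -mulrDr.
  by rewrite ler_wpM2l ?midpoint_ge0 ?energy_triangle.
have E1 : \sum_x \sum_y \sum_z midpoint x y z * energy f x z
    = l%:R ^+ n * kernel_energy f (noise 2^-1).
  rewrite mulr_sumr; apply: eq_bigr => x _.
  rewrite exchange_big mulr_sumr; apply: eq_bigr => z _ /=.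
  by rewrite -mulr_suml midpoint_marginal mulrA.
have E2 : \sum_x \sum_y \sum_z midpoint x y z * energy f z y
    = l%:R ^+ n * kernel_energy f (noise 2^-1).
  rewrite -E1 exchange_big; do 3!(apply: eq_bigr => ? _).
  by rewrite midpointC energyC.
under eq_bigr do under eq_bigr do rewrite big_split /= -!mulr_sumr.
under eq_bigr do rewrite big_split /= -!mulr_sumr.
by rewrite big_split /= -!mulr_sumr E1 E2 le_eqVlt; apply/orP; left; apply/eqP; ring.
Qed.

End Coupling.

(** * From lines to edges *)

Section Paths.
Variables (R : realFieldType) (S : finType) (e : rel S) (D : S -> S -> R).
Hypothesis D_ge0 : forall a b, 0 <= D a b.
Hypothesis Dxx : forall a, D a a = 0.
Hypothesis D_triangle : forall a b c, D a b <= 6 * D a c + 3 * D c b.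

(** Along a path each further edge multiplies the bound by at most 6 + 3, and a
    simple path has fewer edges than there are points. *)
Lemma connected_triangle a b : connect e a b ->
  D a b <= 9 ^+ #|S| * \sum_c \sum_(c' | e c c') D c c'.
Proof.
set M := \sum_c _ => /connectP[p0 ep0 ->].
have M_ge0 : 0 <= M by do 2!(apply: sumr_ge0 => ? _).
case: (shortenP ep0) => p ep Up _.
have edge_le c c' : e c c' -> D c c' <= M.
  move=> ecc'; rewrite /M (bigD1 c) //= (bigD1 c') //= -addrA lerDl addr_ge0 //.
    by apply: sumr_ge0.
  by do 2!(apply: sumr_ge0 => ? _).
have le_path q c : path e c q -> D c (last c q) <= 9 ^+ size q * M.
  elim: q c => [|c' q IH] c /=; first by rewrite Dxx mul1r.
  case/andP=> ecc' /IH le_q; apply: le_trans (D_triangle _ _ c') _.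
  have k1 : 1 <= 9 ^+ size q :> R by rewrite exprn_ege1 // ler1n.
  rewrite exprS; have := edge_le _ _ ecc'; move: k1 le_q.
  set k := 9 ^+ _; set u := D c c'; set v := D c' _ => k1 le_q le_u.
  have : M <= k * M by rewrite ler_peMl.
  lra.
apply: le_trans (le_path _ _ ep) _; rewrite ler_wpM2r //.
rewrite ler_weXn2l ?ler1n //.
by have := card_uniqP Up; have := max_card (mem (a :: p)) => /= + E; rewrite E => /ltnW.
Qed.

End Paths.

Section Lines.
Variables (R : realType) (l n : nat).
Hypothesis l_gt0 : (0 < l)%N.
Local Notation V := {ffun 'I_n -> 'I_l}.
Implicit Types (x y z : V) (i : 'I_n) (a b : 'I_l).

Lemma upd_at x i a : upd x i a i = a.
Proof. by rewrite ffunE eqxx. Qed.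

Lemma upd_id x i : upd x i (x i) = x.
Proof. by apply/ffunP => j; rewrite ffunE; case: eqP => [->|]. Qed.

Lemma upd_upd x i a b : upd (upd x i a) i b = upd x i b.
Proof. by apply/ffunP => j; rewrite !ffunE; case: eqP. Qed.

(** Exchanging the i-th coordinate of x with a is an involution of the pairs
    (x, a). *)
Lemma sum_upd i (h : V -> R) : \sum_x \sum_a h (upd x i a) = l%:R * \sum_x h x.
Proof.
pose sw (p : V * 'I_l) := (upd p.1 i p.2, p.1 i).
have swK : involutive sw.
  by case=> x a; rewrite /sw /= upd_upd upd_id upd_at.
rewrite pair_bigA (reindex_inj (inv_inj swK)) /=.
rewrite -(pair_bigA _ (fun x a => h (upd (upd x i a) i (x i)))) /= mulr_sumr.
apply: eq_bigr => x _.
under eq_bigr do rewrite upd_upd upd_id.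
by rewrite sumr_const card_ord mulr_natl.
Qed.

Variables (G : 'I_n -> sgraph 'I_l).

Lemma sum_cart_adj x (F : V -> R) : \sum_(y | cart_adj G x y) F y
  = \sum_i \sum_(b | adj (G i) (x i) b) F (upd x i b).
Proof.
rewrite pair_big_dep /=.
pose A := [set p : 'I_n * 'I_l | adj (G p.1) (x p.1) p.2].
rewrite [RHS](eq_bigl (fun p => p \in A)); last by move=> p; rewrite inE.
have inj : {in A &, injective (fun p : 'I_n * 'I_l => upd x p.1 p.2)}.
  move=> [i a] [j b]; rewrite !inE /= => adja adjb E.
  have [ij|ij] := eqVneq i j.
    by subst j; congr (_, _); move/ffunP/(_ i): E; rewrite !upd_at.
  have := congr1 (fun z : V => z i) E; rewrite upd_at ffunE (negbTE ij) => ax.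
  by rewrite ax adj_irrefl in adja.
rewrite -(big_imset F inj) /=; apply: eq_bigl => y.
apply/existsP/imsetP => [[i /andP[adji /forallP yE]]|[[i a]]].
  exists (i, y i); rewrite ?inE //=; apply/ffunP => j; rewrite ffunE.
  by case: eqP => [->//|/eqP ji]; have := yE j; rewrite ji => /eqP.
rewrite inE /= => adja ->; exists i; rewrite upd_at adja /=.
by apply/forallP => j; rewrite ffunE; case: (j == i) => /=.
Qed.

Variable f : {perm V} -> R.

Definition graph_energy (T : finType) (H : sgraph T) (h : {perm T} -> R) : R :=
  \sum_x \sum_(y | adj H x y) energy h x y.

Lemma line_energy_le_graph : (forall i, sg_connected (G i)) ->
  line_energy f <= 9 ^+ l * l%:R ^+ 2 * graph_energy (cart_prod G) f.
Proof.
move=> Gconn.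
pose M x i : R := \sum_c \sum_(c' | adj (G i) c c')
   energy f (upd x i c) (upd x i c').
have le_M x i b : energy f x (upd x i b) <= 9 ^+ l * M x i.
  have := @connected_triangle R _ (adj (G i))
    (fun c c' => energy f (upd x i c) (upd x i c')) _ _ _ (x i) b (Gconn i _ _).
  rewrite card_ord upd_id; apply => *; rewrite ?energy_ge0 ?energyxx //.
  exact: energy_triangle.
apply: (@le_trans _ _ (\sum_x \sum_i \sum_(b : 'I_l) 9 ^+ l * M x i)).
  by do 3!(apply: ler_sum => ? _); apply: le_M.
have -> : graph_energy (cart_prod G) f
    = \sum_i \sum_(x : V) \sum_(b | adj (G i) (x i) b) energy f x (upd x i b).
  by rewrite exchange_big; apply: eq_bigr => x _; apply: sum_cart_adj.
rewrite [leLHS]exchange_big mulr_sumr; apply: ler_sum => i _ /=.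
have -> : \sum_x \sum_(b : 'I_l) 9 ^+ l * M x i = l%:R * 9 ^+ l * \sum_x M x i.
  rewrite mulr_sumr; apply: eq_bigr => x _.
  by rewrite sumr_const card_ord -mulrnAl mulr_natl.
rewrite le_eqVlt; apply/orP; left; apply/eqP.
have -> : \sum_x M x i = l%:R * \sum_(x : V) \sum_(b | adj (G i) (x i) b) energy f x (upd x i b).
  rewrite -(sum_upd i); apply: eq_bigr => x _; apply: eq_bigr => c _.
  by rewrite upd_at; apply: eq_bigr => c' _; rewrite upd_upd.
ring.
Qed.

End Lines.

(** * Dirichlet forms and the comparison constant *)

Section Dirichlet.
Variables (R : realType) (T : finType).

(** Every edge is the image of two ordered pairs of adjacent vertices. *)
Lemma sum_edges (H : sgraph T) (B : {set T} -> R) :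
  2 * \sum_(e in edges H) B e = \sum_x \sum_(y | adj H x y) B [set x; y].
Proof.
rewrite pair_big_dep /= (partition_big (fun p => [set p.1; p.2]) (mem (edges H))) /=.
  rewrite mulr_sumr; apply: eq_bigr => e /imsetP[[x y] /= adjxy ->].
  rewrite (eq_bigr (fun=> B [set x; y])) => [|p /andP[_ /eqP->]//].
  rewrite sumr_const mulr_natl; congr (_ *+ _).
  rewrite inE /= in adjxy.
  have xy : x != y by apply: contraTneq adjxy => ->; rewrite adj_irrefl.
  rewrite (_ : 2%N = #|[set (x, y); (y, x)]|); last first.
    by rewrite cards2 xpair_eqE negb_and xy.
  apply: eq_card => -[a b]; rewrite !inE unfold_in /= !xpair_eqE.
  apply/idP/andP => [/orP[]/andP[/eqP-> /eqP->]|[adjab /eqP E]].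
  - by rewrite eqxx.
  - by rewrite adj_sym setUC eqxx.
  have ab : a != b by apply: contraTneq adjab => ->; rewrite adj_irrefl.
  have := set21 a b; have := set22 a b; rewrite E !inE.
  by do 2!case/orP=> /eqP ?; subst; rewrite ?eqxx ?orbT // in ab *.
move=> [x y] /= adjxy; apply/imsetP; exists (x, y) => //; by rewrite inE.
Qed.

Lemma dirichlet_energy (H : sgraph T) (f : {perm T} -> R) :
  dirichlet_IP H f = (4 * (#|T|`!)%:R)^-1 * graph_energy H f.
Proof.
have -> : graph_energy H f = 2 * \sum_(e in edges H)
   \sum_(sigma : {perm T}) (f (edge_tperm e * sigma)%g - f sigma) ^+ 2.
  by rewrite sum_edges; do 2!(apply: eq_bigr => ? _); rewrite edge_tperm2.
rewrite /dirichlet_IP exchange_big /=; field.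
by rewrite pnatr_eq0 -lt0n fact_gt0.
Qed.

Lemma graph_energy_ge0 (H : sgraph T) (f : {perm T} -> R) : 0 <= graph_energy H f.
Proof. by do 2!(apply: sumr_ge0 => ? _); apply: energy_ge0. Qed.

Lemma IP_comparisonP (H : sgraph T) (c : R) : IP_comparison H c <->
  forall f : {perm T} -> R, graph_energy (complete_graph T) f <= c * graph_energy H f.
Proof.
have k0 : 0 < (4 * (#|T|`!)%:R)^-1 :> R.
  by rewrite invr_gt0 mulr_gt0 ?ltr0n ?fact_gt0.
by split=> E f; have := E f; rewrite !dirichlet_energy mulrCA ler_pM2l.
Qed.

(** The admissible constants form a closed set, since they are cut out by
    inequalities that are linear in the constant; the least one is the infimum. *)
Lemma comparison_constant_exists (H : sgraph T) (a b : R) :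
  IP_comparison H b -> (forall c, IP_comparison H c -> a <= c) ->
  exists chi, is_comparison_constant H chi /\ a <= chi <= b.
Proof.
move=> Hb lb_a; pose S (c : R) : Prop := IP_comparison H c.
have S0 : classical_sets.nonempty S by exists b.
have lbS : classical_sets.has_lbound S by exists a => c; apply: lb_a.
exists (inf S); split; last first.
  by apply/andP; split; [apply: lb_le_inf | apply: ge_inf].
split; last by move=> c Sc; apply: ge_inf.
apply/IP_comparisonP => f.
have [E0|En0] := eqVneq (graph_energy H f) 0.
  by move/IP_comparisonP/(_ f): Hb; rewrite E0 !mulr0.
have E_gt0 : 0 < graph_energy H f by rewrite lt_def En0 graph_energy_ge0.
rewrite -ler_pdivrMr //; apply: lb_le_inf => // c /IP_comparisonP/(_ f).
by rewrite ler_pdivrMr.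
Qed.

End Dirichlet.

(** * The lower bound *)

Section OneParticle.
Variables (R : realType) (T : finType) (o : T).

(** The position sigma^-1 o of the particle o is uniform, and a transposition
    moves the particle only when it sits at one of the two endpoints. *)
Lemma energy_one_particle : exists2 m : R, 0 < m &
  forall (g : T -> R) x y,
    energy (fun sigma => g (sigma^-1%g o)) x y = m * (g x - g y) ^+ 2.
Proof.
pose m p : R := \sum_(sigma : {perm T} | sigma o == p) 1.
have mE p : m p = m o.
  rewrite /m (reindex_inj (mulIg (tperm o p))) /=; apply: eq_bigl => sigma.
  by rewrite permM -(inj_eq (@perm_inj _ (tperm o p))) tpermK tpermR.
have m_gt0 : 0 < m o.
  rewrite /m (bigD1 1%g) /= ?perm1 //; apply: ltr_pwDl => //.
  by apply: sumr_ge0 => *; apply: ler01.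
have sum_position (h : T -> R) : \sum_(sigma : {perm T}) h (sigma^-1%g o)
    = m o * \sum_p h p.
  rewrite (reindex_inj invg_inj) /=; under eq_bigr do rewrite invgK.
  rewrite (partition_big (fun sigma : {perm T} => sigma o) predT) //= mulr_sumr.
  apply: eq_bigr => p _; rewrite -(mE p) mulr_suml.
  by apply: eq_bigr => sigma /eqP->; rewrite mul1r.
exists (2 * m o) => [|g x y]; first by rewrite mulr_gt0.
rewrite /energy; under eq_bigr do rewrite invMg tpermV permM.
rewrite (sum_position (fun p => (g (tperm x y p) - g p) ^+ 2)).
have [<-|xy] := eqVneq x y.
  rewrite big1 => [|p _]; last by rewrite tperm1 perm1 subrr expr0n.
  by rewrite subrr expr0n /= !mulr0.
rewrite (bigD1 x) //= (bigD1 y) 1?eq_sym //= big1 => [|p /andP[px py]].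
  by rewrite tpermL tpermR; ring.
by rewrite tpermD 1?eq_sym // subrr expr0n.
Qed.

End OneParticle.

Section LowerBound.
Variables (R : realType) (l n : nat).
Hypotheses (l_gt1 : (1 < l)%N) (n_gt0 : (0 < n)%N).
Local Notation V := {ffun 'I_n -> 'I_l}.
Variable G : 'I_n -> sgraph 'I_l.

(** For a function of one coordinate of one particle, the edges in the other
    directions contribute nothing, and the edges in that direction contribute at
    most as much as a complete graph on l points; the complete graph on the product
    redraws the coordinate at the rate of that graph times l^(n-1). *)
Lemma comparison_lower_bound (c : R) : IP_comparison (cart_prod G) c ->
  l%:R^-1 * #|{: V}|%:R <= c.
Proof.
have l_gt0 : (0 < l)%N by apply: ltnW.
have l0 : 0 < l%:R :> R by rewrite ltr0n.
pose i0 := Ordinal n_gt0; pose a0 := Ordinal l_gt0; pose a1 := Ordinal l_gt1.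
pose x0 : V := [ffun=> a0].
have [m m0 mE] := energy_one_particle R x0.
pose q (a : 'I_l) : R := (a == a0)%:R.
pose f (sigma : {perm V}) := q ((sigma^-1%g x0) i0).
have fE x y : energy f x y = m * (q (x i0) - q (y i0)) ^+ 2.
  by rewrite -(mE (fun x : V => q (x i0))).
move/IP_comparisonP/(_ f).
pose D : R := \sum_(x : V) \sum_(b : 'I_l) m * (q (x i0) - q b) ^+ 2.
have D_gt0 : 0 < D.
  have D_ge0 (x : V) b : 0 <= m * (q (x i0) - q b) ^+ 2.
    by rewrite mulr_ge0 ?sqr_ge0 // ltW.
  rewrite /D (bigD1 x0) //= (bigD1 a1) //= -addrA ltr_pwDl //.
    by rewrite ffunE /q eqxx /= subr0 expr1n mulr1.
  by rewrite addr_ge0 ?sumr_ge0 // => x _; apply: sumr_ge0.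
have G_le : graph_energy (cart_prod G) f <= D.
  rewrite /graph_energy /D; apply: ler_sum => x _.
  rewrite sum_cart_adj (bigD1 i0) //= [X in _ + X]big1 ?addr0 => [|i ii0].
    rewrite [leRHS](bigID (fun b => adj (G i0) (x i0) b)) /=.
    rewrite ler_wpDr //; last by apply: ler_sum => b _; rewrite fE upd_at.
    by apply: sumr_ge0 => b _; rewrite mulr_ge0 ?sqr_ge0 // ltW.
  rewrite big1 // => b _; rewrite fE ffunE eq_sym (negbTE ii0).
  by rewrite subrr expr0n mulr0.
have K_eq : l%:R * graph_energy (complete_graph V) f = #|{: V}|%:R * D.
  rewrite /graph_energy /D !mulr_sumr; apply: eq_bigr => x _.
  rewrite (_ : \sum_(y | _) _ = \sum_y energy f x y); last first.
    rewrite [RHS](bigD1 x) //= energyxx add0r; apply: eq_bigl => y.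
    by rewrite /complete_adj eq_sym.
  rewrite -(sum_upd i0); under eq_bigr do under eq_bigr do rewrite fE upd_at.
  by rewrite sumr_const mulr_natl.
move=> K_le.
have K_gt0 : 0 < l%:R * graph_energy (complete_graph V) f.
  by rewrite K_eq mulr_gt0 // ltr0n; apply/card_gt0P; exists x0.
have c_ge0 : 0 <= c.
  rewrite leNgt; apply/negP => c_lt0; move: K_gt0.
  rewrite pmulr_rgt0 // ltNge (le_trans K_le) //.
  by rewrite mulr_le0_ge0 ?graph_energy_ge0 // ltW.
rewrite mulrC ler_pdivrMr // -(ler_pM2r D_gt0) -K_eq mulrC mulrAC.
rewrite ler_pM2r //; apply: le_trans K_le _.
by rewrite ler_wpM2l.
Qed.

End LowerBound.

(** * The upper bound and the theorem *)

Lemma comparison_upper_bound (R : realType) (l n : nat) (G : 'I_n -> sgraph 'I_l) :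
  (0 < l)%N -> (forall i, sg_connected (G i)) ->
  IP_comparison (cart_prod G)
    (9 ^+ l.+1 * l%:R ^+ 2 * #|{: {ffun 'I_n -> 'I_l}}|%:R : R).
Proof.
move=> l_gt0 Gconn; apply/IP_comparisonP => f.
have -> : graph_energy (complete_graph {ffun 'I_n -> 'I_l}) f = total_energy f.
  apply: eq_bigr => x _; rewrite [RHS](bigD1 x) //= energyxx add0r.
  by apply: eq_bigl => y; rewrite /complete_adj eq_sym.
rewrite card_ffun !card_ord natrX.
apply: le_trans (total_energy_le_noise l_gt0 f) _.
set N := l%:R ^+ n; have N0 : 0 <= N by rewrite exprn_ge0.
rewrite (_ : 9 ^+ l.+1 * _ * N * _
  = 9 * N * (9 ^+ l * l%:R ^+ 2 * graph_energy (cart_prod G) f)); last by rewrite exprS; ring.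
rewrite ler_wpM2l ?mulr_ge0 //.
apply: le_trans (noise_energy_le_line l_gt0 f) _; exact: line_energy_le_graph.
Qed.

Theorem theorem2 (R : realType) (l : nat) (hl : (2 <= l)%N) :
  exists c C : R,
    [/\ 0 < c, c <= C &
      forall (n : nat) (G : 'I_n -> sgraph 'I_l),
        (1 <= n)%N ->
        (forall i : 'I_n, sg_connected (G i)) ->
        exists chi : R,
          is_comparison_constant (cart_prod G) chi /\
          c * #|{: {ffun 'I_n -> 'I_l}}|%:R <= chi
            <= C * #|{: {ffun 'I_n -> 'I_l}}|%:R].
Proof.
have l_gt0 : (0 < l)%N by apply: ltnW.
exists l%:R^-1, (9 ^+ l.+1 * l%:R ^+ 2); split.
- by rewrite invr_gt0 ltr0n.
- apply: (@le_trans _ _ 1); first by rewrite invf_le1 ?ler1n ?ltr0n.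
  by rewrite mulr_ege1 ?exprn_ege1 ?ler1n.
move=> n G n_gt0 Gconn; apply: comparison_constant_exists.
  exact: comparison_upper_bound.
by move=> c; apply: comparison_lower_bound.
Qed.
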